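(* Let $X$ be a nonempty set and let $F\colon X^2\to X$ be an operation. The following assertions are equivalent. (i) $F$ is associative, quasitrivial, and commutative. (ii) $F=\max_{\preceq}$ for some total ordering $\preceq$ on $X$. (iii) $F$ is quasitrivial, commutative, and $\leq$-preserving for some total ordering $\leq$ on $X$. If $X=X_n=\{1,\ldots,n\}$ for some integer $n\geq 1$, then any of the assertions (i)--(iii) is equivalent to any of the following ones. (iv) $F$ is quasitrivial and satisfies $\deg_F=(0,2,4,\ldots,2n-2)$. (v) $F$ is associative, idempotent, commutative, $\leq$-preserving for some total ordering $\leq$ on $X$, and has a neutral element. Moreover, there are exactly $n!$ operations $F\colon X_n^2\to X_n$ satisfying any of the assertions (i)--(v). Furthermore (for $X=X_n$), the total ordering $\preceq$ considered in assertion (ii) is uniquely defined as follows: $x\preceq y$ if and only if $\deg_F(x)\leq\deg_F(y)$. In particular, each of these operations has the (unique) neutral element $e=\min_{\preceq}X_n$ and the (unique) annihilator element $a=\max_{\preceq}X_n$.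
   Context: A total ordering on $X$ is a binary relation on $X$ that is total ($xRy$ or $yRx$ for all $x,y$, hence reflexive), transitive, and antisymmetric. For a total ordering $\preceq$ on $X$, $\max_{\preceq}\colon X^2\to X$ is the binary operation giving the larger of its two arguments for $\preceq$; $\min_{\preceq}X_n$ and $\max_{\preceq}X_n$ denote the least and greatest elements of $X_n$ for $\preceq$. An operation $F\colon X^2\to X$ is: associative if $F(F(x,y),z)=F(x,F(y,z))$ for all $x,y,z$; idempotent if $F(x,x)=x$ for all $x$; quasitrivial if $F(x,y)\in\{x,y\}$ for all $x,y$; commutative if $F(x,y)=F(y,x)$ for all $x,y$; $\leq$-preserving (for a total ordering $\leq$ on $X$) if $x\leq x'$ and $y\leq y'$ imply $F(x,y)\leq F(x',y')$. An element $e$ is a neutral element of $F$ if $F(x,e)=F(e,x)=x$ for all $x\in X$; an element $a$ is an annihilator element of $F$ if $F(x,a)=F(a,x)=a$ for all $x\in X$. For $F\colon X_n^2\to X_n$ and $z\in X_n$, $\deg_F(z)$ is the number of points $(x,y)\in X_n^2\setminus\{(z,z)\}$ such that $F(x,y)=F(z,z)$. The degree sequence $\deg_F$ of $F$ is the nondecreasing $n$-element sequence of the numbers $\deg_F(x)$, $x\in X_n$. *)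

(* Defs.v *)
From mathcomp Require Import all_boot.
From mathcomp Require Import boolp.

Set Implicit Arguments.
Unset Strict Implicit.
Unset Printing Implicit Defensive.

Section AnyType.
Variable X : Type.
Implicit Types (F : X -> X -> X) (R : rel X).

(* Boolean relations stand for arbitrary binary relations: the two are
   identified classically through [asbool]. *)
Definition total_ordering R : Prop :=
  [/\ total R, transitive R & antisymmetric R].

Definition max_op R (x y : X) : X := if R x y then y else x.

Definition quasitrivial F : Prop := forall x y, F x y = x \/ F x y = y.

Definition order_preserving R F : Prop :=
  forall x x' y y', R x x' -> R y y' -> R (F x y) (F x' y').

Definition neutral_element F (e : X) : Prop := left_id e F /\ right_id e F.

Definition annihilator_element F (a : X) : Prop :=
  left_zero a F /\ right_zero a F.

Definition least_element R (e : X) : Prop := forall x, R e x.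

Definition greatest_element R (a : X) : Prop := forall x, R x a.

Definition assertion_i F : Prop :=
  [/\ associative F, quasitrivial F & commutative F].

Definition assertion_ii F : Prop :=
  exists R : rel X, total_ordering R /\ F =2 max_op R.

Definition assertion_iii F : Prop :=
  [/\ quasitrivial F, commutative F &
      exists R : rel X, total_ordering R /\ order_preserving R F].

Definition assertion_v F : Prop :=
  [/\ associative F, idempotent_op F, commutative F,
      exists R : rel X, total_ordering R /\ order_preserving R F &
      exists e : X, neutral_element F e].

End AnyType.

Section Finite.
Variable n : nat.
Implicit Types F : 'I_n -> 'I_n -> 'I_n.

Definition deg F (z : 'I_n) : nat :=
  #|[set p : 'I_n * 'I_n | (p != (z, z)) && (F p.1 p.2 == F z z)]|.

Definition deg_seq F : seq nat := sort leq [seq deg F z | z <- enum 'I_n].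

Definition assertion_iv F : Prop :=
  quasitrivial F /\ deg_seq F = [seq 2 * i | i <- iota 0 n].

Definition num_ops (P : ('I_n -> 'I_n -> 'I_n) -> Prop) : nat :=
  #|[set f : {ffun 'I_n * 'I_n -> 'I_n} | `[< P (fun x y => f (x, y)) >]]|.

End Finite.

(* Main.v *)
Require Import Defs.
From mathcomp Require Import all_boot.
From mathcomp Require Import boolp.
From mathcomp Require Import fingroup perm.

Set Implicit Arguments.
Unset Strict Implicit.
Unset Printing Implicit Defensive.

(** An associative, quasitrivial and commutative [F] is the maximum for the
    relation [F x y = y]; conversely, a quasitrivial commutative [F] preserving
    a total ordering cannot have a 3-cycle for that relation, which is therefore
    transitive. On ['I_n], total orderings are the relations [s x <= s y] for a
    permutation [s], and the maximum for such a relation has degree [2 * s z] at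
    [z], so that [s] can be read off the degrees. In the other direction, if the
    degrees are [2 * s z], then by induction on [s z] the points
    [(x, z)] and [(z, x)] with [s x < s z] are already [2 * s z] points in the
    fibre of [z], hence are all of it, and [z] loses to all [x] with
    [s z < s x]. *)

Section AnyType.
Variable X : Type.
Implicit Types (F : X -> X -> X) (R : rel X).

(** * Total orderings and their maximum operations *)

Lemma total_ordering_refl R : total_ordering R -> reflexive R.
Proof. by case=> totR _ _ x; have := totR x x; rewrite orbb. Qed.

Lemma eq_total_ordering R R' : R =2 R' -> total_ordering R -> total_ordering R'.
Proof.
by move=> eqR; suff -> : R' = R by []; apply/funext=> x; apply/funext=> y.
Qed.

Lemma eq_max_op F R R' : R =2 R' -> F =2 max_op R -> F =2 max_op R'.
Proof. by move=> eqR eqF x y; rewrite eqF /max_op eqR. Qed.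

Lemma max_opC R : total_ordering R -> commutative (max_op R).
Proof.
case=> totR _ antiR x y; rewrite /max_op.
case Rxy: (R x y); case Ryx: (R y x) => //; first by apply: antiR; rewrite Ryx.
by have := totR x y; rewrite Rxy Ryx.
Qed.

Lemma max_opA R : total_ordering R -> associative (max_op R).
Proof.
case=> totR trR antiR x y z; rewrite /max_op.
have [Ryz|nRyz] := boolP (R y z).
  by case Rxy: (R x y); rewrite ?Ryz ?(trR _ _ _ Rxy Ryz).
case Rxy: (R x y); rewrite ?(negbTE nRyz) //.
have Ryx : R y x by have := totR x y; rewrite Rxy.
by case Rxz: (R x z) => //; rewrite (trR _ _ _ Ryx Rxz) in nRyz.
Qed.

Lemma max_op_homo R : total_ordering R -> order_preserving R (max_op R).
Proof.
move=> oR; have [totR trR _] := oR => x x' y y' Rx Ry; rewrite /max_op.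
case Rxy: (R x y); case Rxy': (R x' y') => //.
  have Ry'x' : R y' x' by have := totR x' y'; rewrite Rxy'.
  exact: trR Ry Ry'x'.
exact: trR Rx Rxy'.
Qed.

Lemma max_op_quasitrivial R : quasitrivial (max_op R).
Proof. by move=> x y; rewrite /max_op; case: ifP; [right | left]. Qed.

Lemma neutral_max_op R F e : total_ordering R -> F =2 max_op R ->
  least_element R e -> unique (neutral_element F) e.
Proof.
move=> oR eqF le_e.
have Fe x : F e x = x by rewrite eqF /max_op le_e.
split; first by split=> x //; rewrite eqF max_opC // -eqF.
by move=> e' [Fe' _]; rewrite -[LHS]Fe' eqF max_opC // -eqF Fe.
Qed.

Lemma annihilator_max_op R F a : total_ordering R -> F =2 max_op R ->
  greatest_element R a -> unique (annihilator_element F) a.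
Proof.
move=> oR eqF le_a.
have Fa x : F x a = a by rewrite eqF /max_op le_a.
split; first by split=> x //; rewrite eqF max_opC // -eqF.
by move=> a' [Fa' _]; rewrite -(Fa a') Fa'.
Qed.

(** The candidate ordering is [F x y = y]: quasitriviality and commutativity make it total, and
    commutativity makes it antisymmetric, so only transitivity is left as a hypothesis. *)
Lemma assertion_ii_of_trans F : quasitrivial F -> commutative F ->
  (forall x y z, F x y = y -> F y z = z -> F x z = z) -> assertion_ii F.
Proof.
move=> qF FC trF; exists (fun x y => `[< F x y = y >]); split; last first.
  move=> x y; rewrite /max_op; case: ifPn => [/asboolP //|/asboolPn nF].
  by case: (qF x y).
split=> [x y|y x z /asboolP Fxy /asboolP Fyz|x y].
- apply/orP; case: (qF x y) => Fxy; [right | left]; apply/asboolP => //.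
  by rewrite FC.
- by apply/asboolP/(trF x y).
- by case/andP=> /asboolP Fxy /asboolP Fyx; rewrite -Fyx FC.
Qed.

Lemma assertion_i_ii F : assertion_i F -> assertion_ii F.
Proof.
move=> [FA qF FC]; apply: assertion_ii_of_trans => // x y z Fxy Fyz.
by rewrite -Fyz FA Fxy.
Qed.

Lemma assertion_ii_iii F : assertion_ii F -> assertion_iii F.
Proof.
case=> R [oR eqF]; have -> : F = max_op R.
  by apply/funext=> x; apply/funext=> y.
split; [exact: max_op_quasitrivial | exact: max_opC |].
by exists R; split=> //; apply: max_op_homo.
Qed.

Lemma assertion_iii_ii F : assertion_iii F -> assertion_ii F.
Proof.
case=> qF FC [R [oR homoF]]; have [totR trR antiR] := oR.
have mono w u v : R u v -> R (F u w) (F v w).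
  by move=> Ruv; apply: homoF; last exact: total_ordering_refl.
apply: assertion_ii_of_trans => // x y z Fxy Fyz.
case: (qF x z) => // Fxz.
(* In a 3-cycle, combining [x <= y] with [z], then the result with [y], then
   with [x], gives [x <= z], [y <= z] and [y <= x]; likewise for [y <= x]. *)
have xyE : R x y = R y x.
  apply/idP/idP.
    move=> /(mono z); rewrite Fxz Fyz => /(mono y).
    by rewrite Fxy (FC z) Fyz => /(mono x); rewrite !(FC _ x) Fxy Fxz.
  move=> /(mono z); rewrite Fxz Fyz => /(mono y).
  by rewrite Fxy (FC z) Fyz => /(mono x); rewrite !(FC _ x) Fxy Fxz.
have Rxy : R x y by have := totR x y; rewrite -xyE orbb.
by rewrite (antiR x y) // -xyE Rxy.
Qed.

Lemma assertion_ii_i F : assertion_ii F -> assertion_i F.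
Proof.
case=> R [oR eqF]; have -> : F = max_op R.
  by apply/funext=> x; apply/funext=> y.
by split; [exact: max_opA | exact: max_op_quasitrivial | exact: max_opC].
Qed.

Lemma assertion_v_i F : assertion_v F -> assertion_i F.
Proof.
case=> FA FI FC [R [oR homoF]] [e [Fe eF]]; split=> //.
have [totR trR antiR] := oR; have Rxx := total_ordering_refl oR.
(* [F] is the maximum above the neutral element and the minimum below it;
   if [x <= e <= y], then [z = F x y] satisfies [F x z = z = F z y], so
   comparing [z] with [e] gives [z = x] or [z = y]. *)
have Fge x y : R e x -> R x y -> F x y = y.
  move=> Rex Rxy; apply: antiR; apply/andP; split.
    by have := homoF _ _ _ _ Rxy (Rxx y); rewrite FI.
  by have := homoF _ _ _ _ Rex (Rxx y); rewrite Fe.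
have Fle x y : R x y -> R y e -> F x y = x.
  move=> Rxy Rye; apply: antiR; apply/andP; split.
    by have := homoF _ _ _ _ (Rxx x) Rye; rewrite eF.
  by have := homoF _ _ _ _ (Rxx x) Rxy; rewrite FI.
suff qF x y : R x y -> F x y = x \/ F x y = y.
  move=> x y; case/orP: (totR x y) => /qF //.
  by rewrite FC => -[]; [right | left].
move=> Rxy; case/orP: (totR e x) => [Rex|Rxe]; first by right; apply: Fge.
case/orP: (totR y e) => [Rye|Rey]; first by left; apply: Fle.
have Rxz : R x (F x y) by have := homoF _ _ _ _ (Rxx x) Rxy; rewrite FI.
have Rzy : R (F x y) y by have := homoF _ _ _ _ Rxy (Rxx y); rewrite FI.
case/orP: (totR e (F x y)) => [Rez|Rze].
  by right; have := Fge _ _ Rez Rzy; rewrite -FA FI.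
by left; have := Fle _ _ Rxz Rze; rewrite FA FI.
Qed.

End AnyType.

Section Finite.
Variable n : nat.
Implicit Types (F : 'I_n -> 'I_n -> 'I_n) (R : rel 'I_n) (s : 'S_n).

(** * Total orderings of ['I_n] as permutations *)

Definition perm_rel s : rel 'I_n := fun x y => s x <= s y.

Lemma perm_rel_total_ordering s : total_ordering (perm_rel s).
Proof.
split=> [x y|y x z|x y].
- exact: leq_total.
- exact: leq_trans.
- by move=> /anti_leq /val_inj /perm_inj.
Qed.

(** The permutation sends [x] to its rank, the number of elements strictly below it. This is less
    than [n] because [x] is not below itself, and antisymmetry makes it injective. *)
Lemma total_ordering_perm R :
  total_ordering R -> exists s, R =2 perm_rel s.
Proof.
move=> oR; have [totR trR antiR] := oR.
have Rxx := total_ordering_refl oR.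
pose below x := [set y | ~~ R x y].
have mono x y : ~~ R x y -> #|below y| < #|below x|.
  move=> nRxy; have Ryx : R y x by have := totR x y; rewrite (negbTE nRxy).
  apply/proper_card/properP; split.
    by apply/subsetP=> z; rewrite !inE; apply/contra/(trR _ _ _ Ryx).
  by exists y; rewrite inE ?nRxy ?Rxx.
have ltn x : #|below x| < n.
  rewrite -[X in _ < X]card_ord -cardsT; apply/proper_card/properP; split.
    exact: subsetT.
  by exists x; rewrite inE // Rxx.
have rankE x y : R x y = (#|below x| <= #|below y|).
  apply/idP/idP; last by apply/contraLR; rewrite -ltnNge; apply: mono.
  move=> Rxy; apply/subset_leq_card/subsetP=> z; rewrite !inE.
  by apply/contra/(trR _ _ _ Rxy).
have rank_inj : injective (fun x => Ordinal (ltn x)).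
  by move=> x y [eq_xy]; apply: antiR; rewrite !rankE eq_xy leqnn.
by exists (perm rank_inj) => x y; rewrite rankE /perm_rel !permE.
Qed.

Lemma total_ordering_least R :
  0 < n -> total_ordering R -> exists e, least_element R e.
Proof.
move=> n_gt0 /total_ordering_perm[s eqR]; exists (s^-1%g (Ordinal n_gt0)) => x.
by rewrite eqR /perm_rel permKV.
Qed.

Lemma total_ordering_greatest R :
  0 < n -> total_ordering R -> exists a, greatest_element R a.
Proof.
move=> n_gt0 /total_ordering_perm[s eqR].
have ltn1n : n.-1 < n by rewrite prednK.
exists (s^-1%g (Ordinal ltn1n)) => x.
by rewrite eqR /perm_rel permKV /= -ltnS prednK.
Qed.

(** * Degrees and assertion (iv) *)

Definition cross (z : 'I_n) (A : {set 'I_n}) : {set 'I_n * 'I_n} :=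
  setX A [set z] :|: setX [set z] A.

Lemma card_cross z (A : {set 'I_n}) : z \notin A -> #|cross z A| = 2 * #|A|.
Proof.
move=> zA; rewrite cardsU !cardsX !cards1 muln1 mul1n mul2n addnn.
rewrite (_ : _ :&: _ = set0) ?cards0 ?subn0 //.
apply/setP=> -[x y]; rewrite !inE /=.
apply/negP=> /andP[/andP[xA _] /andP[/eqP xz _]].
by rewrite xz (negbTE zA) in xA.
Qed.

Lemma card_perm_below s z : #|[set x | s x < s z]| = s z.
Proof.
have -> : #|[set x | s x < s z]| = \sum_(i < n | i < s z) 1.
  by rewrite (reindex_perm s) -sum1_card; apply: eq_bigl => x; rewrite inE.
by rewrite -(big_ord_widen n (fun=> 1)) ?sum1_card ?card_ord // ltnW.
Qed.

Lemma card_cross_perm_below s z : #|cross z [set x | s x < s z]| = 2 * s z.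
Proof. by rewrite card_cross ?card_perm_below // inE ltnn. Qed.

(** A point other than [(z, z)] has maximum [z] exactly when one coordinate is [z] and the other is
    strictly below it, so these points form a cross. *)
Lemma deg_max_perm F s z : F =2 max_op (perm_rel s) -> deg F z = 2 * s z.
Proof.
move=> eqF; rewrite -card_cross_perm_below; apply: eq_card => -[x y].
have sE (u v : 'I_n) : (s u == s v) = (u == v) by rewrite (inj_eq perm_inj).
rewrite !inE /= !eqF /max_op /perm_rel leqnn xpair_eqE.
have [->|zx] := eqVneq x z; have [->|zy] := eqVneq y z;
  rewrite ?ltnn ?andbF //=.
- by rewrite leqNgt; case: ltnP => /= _; rewrite ?eqxx ?(negbTE zy).
- rewrite andbT orbF leq_eqVlt (inj_eq val_inj) sE (negbTE zx) /=.
  by case: ifP; rewrite ?eqxx ?(negbTE zx).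
- by case: ifP; rewrite ?(negbTE zx) ?(negbTE zy).
Qed.

Lemma deg_seqP F :
  deg_seq F = [seq 2 * i | i <- iota 0 n] <->
  exists s, forall x, deg F x = 2 * s x.
Proof.
have sorted_evens : sorted leq [seq 2 * i | i <- iota 0 n].
  by apply: homo_sorted (iota_sorted 0 n) => i j; rewrite leq_mul2l.
have perm_evens : deg_seq F = [seq 2 * i | i <- iota 0 n] <->
    perm_eq [seq deg F z | z <- enum 'I_n] [seq 2 * i | i <- iota 0 n].
  (* The sequence of even numbers is its own sorting, so equality with [deg_seq F] is equality of
     two sorted sequences, that is, [perm_eq] of the unsorted ones. *)
  rewrite /deg_seq -{1}(sorted_sort leq_trans sorted_evens).
  exact: rwP (perm_sortP leq_total leq_trans anti_leq _ _).
rewrite perm_evens; split=> [degP|[s degE]].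
(* Halving the degrees gives a map into ['I_n], injective because the even numbers listed are
   distinct. *)
- have degE x : {i : 'I_n | deg F x = 2 * i}.
    apply/cid; have : deg F x \in [seq 2 * i | i <- iota 0 n].
      by rewrite -(perm_mem degP) map_f // mem_enum.
    by case/mapP=> i; rewrite mem_iota => ltin ->; exists (Ordinal ltin).
  have deg_inj : injective (fun x => sval (degE x)).
    move=> x y eq_xy; have : uniq [seq deg F z | z <- enum 'I_n].
      by rewrite (perm_uniq degP) map_inj_uniq ?iota_uniq // => i j /eqP;
         rewrite eqn_mul2l => /eqP.
    move=> /injectiveP; apply.
    by rewrite (svalP (degE x)) (svalP (degE y)) eq_xy.
  by exists (perm deg_inj) => x; rewrite permE; apply: svalP (degE x).
- rewrite (eq_map degE) (map_comp (muln 2) (fun x => val (s x))) perm_map //.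
  have s_uniq : uniq [seq val (s x) | x <- enum 'I_n].
    by rewrite map_inj_uniq ?enum_uniq // => x y /val_inj /perm_inj.
  (* The [n] distinct values of [s], all below [n], exhaust [iota 0 n]. *)
  have [|| _ eq_mem] := uniq_min_size (s2 := iota 0 n) s_uniq.
  + by move=> _ /mapP[x _ ->]; rewrite mem_iota /=.
  + by rewrite size_map size_iota size_enum_ord.
  exact: uniq_perm s_uniq (iota_uniq 0 n) eq_mem.
Qed.

Lemma deg_perm_max F s : quasitrivial F -> (forall x, deg F x = 2 * s x) ->
  F =2 max_op (perm_rel s).
Proof.
move=> qF degE; have Fxx x : F x x = x by case: (qF x x).
suff win z x : s z < s x -> F x z = x /\ F z x = x.
  move=> x y; rewrite /max_op /perm_rel.
  case: ltngtP => [/win[]|/win[]|/val_inj/perm_inj ->] //.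
have lt_neq u v : s u < s v -> u != v by apply: contraTneq => ->; rewrite ltnn.
have [k] := ubnP (s z); elim: k => // k IHk in z x * => /ltnSE lezk ltzx.
(* The induction hypothesis, applied to the elements below [z], puts the cross inside the fibre;
   both have [2 * s z] points, so they coincide. *)
have /eqP fibre : cross z [set x | s x < s z] ==
    [set p | (p != (z, z)) && (F p.1 p.2 == F z z)].
  rewrite eqEcard card_cross_perm_below -[#|_|]/(deg F z) degE leqnn andbT.
  apply/subsetP=> -[u v]; rewrite !inE Fxx xpair_eqE /=.
  case/orP=> /andP[].
    move=> ltuz /eqP ->; have [_ ->] := IHk _ _ (leq_trans ltuz lezk) ltuz.
      by rewrite !eqxx (negbTE (lt_neq _ _ ltuz)).
  move=> /eqP -> ltvz; have [-> _] := IHk _ _ (leq_trans ltvz lezk) ltvz.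
  by rewrite !eqxx (negbTE (lt_neq _ _ ltvz)).
have nzx : x != z by rewrite eq_sym lt_neq.
(* As [x] is above [z], the point [(x, z)] lies outside the cross, hence outside the fibre;
   quasitriviality then leaves only the value [x]. *)
have nFxz : F x z != z.
  move/setP/(_ (x, z)): fibre; rewrite !inE Fxx xpair_eqE /= (negbTE nzx) /=.
  by rewrite ltnNge ltnW //= => <-.
have nFzx : F z x != z.
  move/setP/(_ (z, x)): fibre; rewrite !inE Fxx xpair_eqE /= (negbTE nzx) /=.
  by rewrite eqxx andbF ltnNge ltnW //= => <-.
split; first by case: (qF x z) => // /eqP; rewrite (negbTE nFxz).
by case: (qF z x) => // /eqP; rewrite (negbTE nFzx).
Qed.

Lemma assertion_iiP F :
  assertion_ii F <-> exists s, F =2 max_op (perm_rel s).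
Proof.
split=> [[R [oR eqF]]|[s eqF]].
  have [s eqR] := total_ordering_perm oR.
  by exists s; apply: eq_max_op eqF.
by exists (perm_rel s); split; [exact: perm_rel_total_ordering|].
Qed.

Lemma assertion_ii_iv F : assertion_ii F <-> assertion_iv F.
Proof.
rewrite assertion_iiP /assertion_iv deg_seqP; split=> [[s eqF]|[qF [s degE]]].
  split; last by exists s => z; apply: deg_max_perm.
  by move=> x y; rewrite eqF; apply: max_op_quasitrivial.
by exists s; apply: deg_perm_max.
Qed.

(** Both sides compare [s x] with [s y], the degrees being twice these ranks. This is what makes the
    ordering unique. *)
Lemma total_ordering_degE F R : total_ordering R -> F =2 max_op R ->
  forall x y, R x y = (deg F x <= deg F y).
Proof.
move=> oR eqF x y; have [s eqR] := total_ordering_perm oR.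
by rewrite eqR !(deg_max_perm _ (eq_max_op eqR eqF)) leq_mul2l.
Qed.

(** Permutations correspond bijectively to the operations counted: the degrees of a maximum
    operation recover its permutation. *)
Lemma num_ops_assertion_ii : num_ops (@assertion_ii 'I_n) = n`!.
Proof.
pose op s : {ffun 'I_n * 'I_n -> 'I_n} :=
  [ffun p => max_op (perm_rel s) p.1 p.2].
have op_inj : injective op.
  move=> s t eq_st; apply/permP=> z; apply/val_inj/eqP.
  have eqF u : (fun x y => op u (x, y)) =2 max_op (perm_rel u).
    by move=> x y; rewrite ffunE.
  by rewrite -(eqn_pmul2l (isT : 0 < 2)) -(deg_max_perm _ (eqF s)) eq_st
    -(deg_max_perm _ (eqF t)).
rewrite -card_Sn -(card_imset predT op_inj); apply: eq_card => f.
rewrite inE; apply/asboolP/imsetP => [/assertion_iiP[s eqF]|[s _ ->]].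
  by exists s => //; apply/ffunP=> -[x y]; rewrite ffunE -eqF.
by apply/assertion_iiP; exists s => x y; rewrite ffunE.
Qed.

Lemma eq_num_ops P Q : (forall F, P F <-> Q F) -> num_ops P = num_ops Q.
Proof.
by move=> eqPQ; apply: eq_card => f; rewrite !inE; apply: asbool_equiv_eq.
Qed.

End Finite.

Theorem theorem3p3 :
  (forall (X : Type) (F : X -> X -> X), inhabited X ->
     [<-> assertion_i F; assertion_ii F; assertion_iii F]) /\
  (forall n : nat, 1 <= n ->
     [/\ forall F : 'I_n -> 'I_n -> 'I_n,
           [<-> assertion_i F; assertion_ii F; assertion_iii F;
                assertion_iv F; assertion_v F],
         [/\ num_ops (@assertion_i 'I_n) = n`!,
             num_ops (@assertion_ii 'I_n) = n`!,
             num_ops (@assertion_iii 'I_n) = n`!,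
             num_ops (@assertion_iv n) = n`! &
             num_ops (@assertion_v 'I_n) = n`!],
         forall F : 'I_n -> 'I_n -> 'I_n, assertion_ii F ->
           forall R : rel 'I_n,
             (total_ordering R /\ F =2 max_op R) <->
             (forall x y : 'I_n, R x y = (deg F x <= deg F y)) &
         forall (F : 'I_n -> 'I_n -> 'I_n) (R : rel 'I_n),
           total_ordering R -> F =2 max_op R ->
           (exists e : 'I_n,
              least_element R e /\ unique (neutral_element F) e) /\
           (exists a : 'I_n,
              greatest_element R a /\ unique (annihilator_element F) a)]).
Proof.
split=> [X F _|n n_gt0].
  tfae; [exact: assertion_i_ii | exact: assertion_ii_iii |].
  by move=> /assertion_iii_ii/assertion_ii_i.
have equiv (F : 'I_n -> 'I_n -> 'I_n) :
    [<-> assertion_i F; assertion_ii F; assertion_iii F;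
         assertion_iv F; assertion_v F].
  tfae; [exact: assertion_i_ii | exact: assertion_ii_iii | | |
    exact: assertion_v_i].
    by move=> /assertion_iii_ii/assertion_ii_iv.
  move=> /assertion_ii_iv iiF; have [FA qF FC] := assertion_ii_i iiF.
  have [_ _ homoF] := assertion_ii_iii iiF.
  split=> //; first by move=> x; case: (qF x x).
  have [R [oR eqF]] := iiF.
  (* The neutral element demanded by (v) is the least element, which exists because ['I_n] is
     nonempty. *)
  have [e le_e] := total_ordering_least n_gt0 oR.
  by exists e; have [] := neutral_max_op oR eqF le_e.
have numE (P : ('I_n -> 'I_n -> 'I_n) -> Prop) :
    (forall F, P F <-> assertion_ii F) -> num_ops P = n`!.
  by move=> PE; rewrite (eq_num_ops PE) num_ops_assertion_ii.
split=> //.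
- by split; apply: numE => F; [apply: (equiv F 0 1) | | apply: (equiv F 2 1)
    | apply: (equiv F 3 1) | apply: (equiv F 4 1)].
- move=> F [R0 [oR0 eqF0]] R; split=> [[oR eqF]|degR].
    exact: total_ordering_degE.
  (* The degrees determine both relations, so [R] inherits everything from the ordering [R0]
     supplied by (ii). *)
  have eqR : R0 =2 R by move=> x y; rewrite degR (total_ordering_degE oR0 eqF0).
  by split; [exact: eq_total_ordering oR0 | exact: eq_max_op eqF0].
- move=> F R oR eqF; split.
    have [e le_e] := total_ordering_least n_gt0 oR.
    by exists e; split=> //; apply: neutral_max_op le_e.
  have [a le_a] := total_ordering_greatest n_gt0 oR.
  by exists a; split=> //; apply: annihilator_max_op le_a.
Qed.
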